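(* Let $r\geq 2$ and let $H_1,\ldots,H_r$ be finite simple regular graphs (not necessarily connected), each of positive degree. Then the Cartesian product $H_1\times H_2\times\cdots\times H_r$ is antimagic.
   Context: All graphs are finite, undirected and simple. A graph is $k$-regular if every vertex has degree $k$; regular if it is $k$-regular for some $k$. An antimagic labeling of a graph with $m$ edges and $n$ vertices is a bijection from the edge set to $\{1,\ldots,m\}$ such that the $n$ vertex sums are pairwise distinct, where the vertex sum at $v$ is the sum of the labels of all edges incident with $v$. A graph is antimagic if it has an antimagic labeling. The Cartesian product $G_1\times G_2$ of $G_1=(V_1,E_1)$ and $G_2=(V_2,E_2)$ has vertex set $V_1\times V_2$, with $(u_1,u_2)$ adjacent to $(v_1,v_2)$ iff either $u_1=v_1$ and $u_2v_2\in E_2$, or $u_2=v_2$ and $u_1v_1\in E_1$; products of more factors are defined iteratively. *)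

(* Defs.v *)
From mathcomp Require Import all_boot.

Set Implicit Arguments.
Unset Strict Implicit.
Unset Printing Implicit Defensive.

Record sgraph := SGraph {
  vertex :> finType;
  adj : rel vertex;
  adj_sym : symmetric adj;
  adj_irrefl : irreflexive adj
}.

Definition degree (G : sgraph) (v : G) : nat := #|[set w : G | adj v w]|.

Definition k_regular (k : nat) (G : sgraph) : Prop :=
  forall v : G, degree v = k.

(* Edges are unordered pairs, i.e. two-element vertex sets. *)
Definition edges (G : sgraph) : {set {set G}} :=
  [set e | [exists u : G, exists v : G, adj u v && (e == [set u; v])]].

(* Labelings are total functions on vertex sets of which only the values on
   [edges G] are constrained or used. *)
Definition edge_labeling (G : sgraph) (f : {set G} -> nat) : Prop :=
  [/\ {in edges G, forall e, 1 <= f e <= #|edges G|},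
      {in edges G &, injective f}
    & forall k, 1 <= k <= #|edges G| -> exists2 e, e \in edges G & f e = k].

Definition vertex_sum (G : sgraph) (f : {set G} -> nat) (v : G) : nat :=
  \sum_(e in edges G | v \in e) f e.

Definition antimagic_labeling (G : sgraph) (f : {set G} -> nat) : Prop :=
  edge_labeling f /\ injective (vertex_sum f).

Definition antimagic (G : sgraph) : Prop :=
  exists f : {set G} -> nat, antimagic_labeling f.

Section CartesianProduct.

Variables G1 G2 : sgraph.

Definition cart_adj : rel (G1 * G2) := fun u v =>
  (u.1 == v.1) && adj u.2 v.2 || (u.2 == v.2) && adj u.1 v.1.

Lemma cart_adj_sym : symmetric cart_adj.
Proof.
by move=> u v; rewrite /cart_adj (eq_sym u.1) (eq_sym u.2) !(adj_sym u.1, adj_sym u.2).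
Qed.

Lemma cart_adj_irrefl : irreflexive cart_adj.
Proof. by move=> u; rewrite /cart_adj !adj_irrefl !andbF. Qed.

Definition cart : sgraph := SGraph cart_adj_sym cart_adj_irrefl.

End CartesianProduct.

Lemma K1_sym : symmetric (fun _ _ : unit => false).
Proof. by []. Qed.

Lemma K1_irrefl : irreflexive (fun _ _ : unit => false).
Proof. by []. Qed.

Definition K1 : sgraph := SGraph K1_sym K1_irrefl.

(* [((H 0 x H 1) x ...) x H n] *)
Fixpoint cart_iter (n : nat) : ('I_n.+1 -> sgraph) -> sgraph :=
  match n with
  | 0 => fun H => H ord0
  | m.+1 => fun H =>
      cart (cart_iter (fun i : 'I_m.+1 => H (widen_ord (leqnSn m.+1) i)))
           (H ord_max)
  end.

(* The product of no factors is, by convention, the one-vertex graph. *)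
Definition cart_prod (r : nat) : ('I_r -> sgraph) -> sgraph :=
  match r with
  | 0 => fun _ => K1
  | n.+1 => fun H => cart_iter H
  end.

(* Main.v *)
(* The product of the first r-1 factors is regular, so two factors G (k-regular,
   m edges, n vertices) and H (l-regular) suffice, and by symmetry l <= k. The
   copies of G, one for each vertex u of H, get consecutive blocks of m labels,
   ordered by the vertex sums t(u) of a labeling of H; the n parallel copies of
   each edge of H get a block of n labels, ordered like the vertex sums s(v) of a
   labeling of G. With p, q the ranks of v, u and up to a constant, the sum at
   (v, u) is then (k m q(u) + n t(u)) + (s(v) + l p(v)). This is increasing in p(v)
   for fixed u, and the copies of G do not overlap if s varies by less than
   k m - l (n - 1).
   For k >= 3 such a labeling of G comes from a decomposition of its edges into
   trails in which every vertex is an end once (k odd) or twice (k even):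
   labelling along the trails 0, m-1, 1, m-2, ... makes any two consecutive labels
   add up to m-1 or m.
   For k = l = 2, G and H are both given antimagic labelings, and reversing the
   blocks of the odd-labelled edges of H leaves enough room; for k = 2, l = 1 the
   two copies of G joined by an edge of H are interleaved; for k = l = 1 the
   product is 2-regular, and 2-regular graphs are antimagic. *)

Require Import Defs.
From mathcomp Require Import all_boot zify.

Set Implicit Arguments.
Unset Strict Implicit.
Unset Printing Implicit Defensive.

(** * Edges and vertex sums *)

Lemma eq_set2 (T : finType) (a b c d : T) :
  [set a; b] = [set c; d] -> (a = c /\ b = d) \/ (a = d /\ b = c).
Proof.
move=> E.
have : a \in [set c; d] by rewrite -E set21.
have : b \in [set c; d] by rewrite -E set22.
have : c \in [set a; b] by rewrite E set21.
have : d \in [set a; b] by rewrite E set22.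
rewrite !inE => /orP[]/eqP-> /orP[]/eqP-> /orP[]/eqP? /orP[]/eqP?; subst; auto.
Qed.

Section Basics.
Variable G : sgraph.
Implicit Types (u v w : G) (e : {set G}).

Lemma edgeP e :
  reflect (exists u v, adj u v /\ e = [set u; v]) (e \in edges G).
Proof.
rewrite inE; apply: (iffP existsP) => [[u /existsP[v /andP[uv /eqP->]]]|].
  by exists u, v.
by move=> [u [v [uv ->]]]; exists u; apply/existsP; exists v; rewrite uv eqxx.
Qed.

Lemma edge_adj u v : ([set u; v] \in edges G) = adj u v.
Proof.
apply/edgeP/idP => [[a [b [ab /eq_set2]]]|]; last by exists u, v.
by case=> [[-> ->]|[-> ->]] //; rewrite adj_sym.
Qed.

Lemma adj_neq u v : adj u v -> u != v.
Proof. by apply: contraTneq => ->; rewrite adj_irrefl. Qed.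

Lemma edge_card e : e \in edges G -> #|e| = 2.
Proof. by case/edgeP=> u [v [/adj_neq uv ->]]; rewrite cards2 uv. Qed.

Lemma vertex_sum_adj (f : {set G} -> nat) v :
  vertex_sum f v = \sum_(w | adj v w) f [set v; w].
Proof.
rewrite /vertex_sum (eq_bigl [in [set [set v; w] | w in [pred w | adj v w]]]).
  rewrite big_imset //= => a b _ _ /eq_set2[[]//|[-> ->]//].
move=> e; apply/andP/imsetP => [[/edgeP[a [b [ab ->]]]]|[w vw ->]].
  rewrite !inE => /orP[]/eqP->; first by exists b.
  by exists a; rewrite ?inE 1?adj_sym // setUC.
by rewrite edge_adj set21.
Qed.

Lemma vertex_sum_const c k v :
  k_regular k G -> vertex_sum (fun=> c) v = k * c.
Proof.
by move=> /(_ v) <-; rewrite vertex_sum_adj sum_nat_const /degree cardsE.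
Qed.

Lemma vertex_sumD (f g : {set G} -> nat) v :
  vertex_sum (fun e => f e + g e) v = vertex_sum f v + vertex_sum g v.
Proof. by rewrite /vertex_sum big_split. Qed.

Lemma vertex_sumZ c (f : {set G} -> nat) v :
  vertex_sum (fun e => c * f e) v = c * vertex_sum f v.
Proof. by rewrite /vertex_sum big_distrr. Qed.

Lemma eq_vertex_sum (f g : {set G} -> nat) v :
  (forall e, e \in edges G -> v \in e -> f e = g e) ->
  vertex_sum f v = vertex_sum g v.
Proof. by move=> fg; apply: eq_bigr => e /andP[]; apply: fg. Qed.

Lemma handshake k : k_regular k G -> #|edges G| * 2 = k * #|G|.
Proof.
move=> Gk; transitivity (\sum_(v : G) vertex_sum (fun=> 1) v); last first.
  rewrite (eq_bigr (fun=> k)) ?sum_nat_const 1?mulnC // => v _.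
  by rewrite (vertex_sum_const _ _ Gk) muln1.
rewrite /vertex_sum (exchange_big_dep [in edges G]) /=; last by move=> ? ? _ /andP[].
rewrite -sum_nat_const; apply: eq_bigr => e eE.
by rewrite -(edge_card eE) -sum1_card; apply: eq_bigl => v; rewrite eE.
Qed.

(** Labels may start at 0: in a [k]-regular graph, raising every label by one adds [k] to every
    vertex sum and so keeps the sums distinct. *)
Lemma antimagic_intro k (f : {set G} -> nat) :
  k_regular k G ->
  {in edges G, forall e, f e < #|edges G|} ->
  {in edges G &, injective f} ->
  injective (vertex_sum f) ->
  antimagic G.
Proof.
move=> Gk flt finj sinj; exists (fun e => 1 + f e); split; last first.
  by move=> u v; rewrite !vertex_sumD !(vertex_sum_const _ _ Gk) => /addnI/sinj.
split=> [e /flt//|e e' eE e'E [] /finj->//|c /andP[c0 cm]].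
(* As many distinct labels as there are available values: every value is used. *)
have [|||_ Ef] := @uniq_min_size _ [seq f e | e in edges G] (iota 0 #|edges G|).
- by rewrite map_inj_in_uniq ?enum_uniq // => e e'; rewrite !mem_enum; apply: finj.
- by move=> x /mapP[e]; rewrite mem_enum mem_iota => /flt ? ->.
- by rewrite size_iota size_map -cardE.
have: c.-1 \in iota 0 #|edges G| by rewrite mem_iota; lia.
rewrite -Ef => /mapP[e]; rewrite mem_enum => eE ce; exists e => //; lia.
Qed.

End Basics.

Lemma antimagic_iso (G G' : sgraph) (phi : G -> G') :
  bijective phi -> (forall u v, adj (phi u) (phi v) = adj u v) ->
  antimagic G' -> antimagic G.
Proof.
move=> phib phia [f [[f1 f2 f3] fs]].
have phii := bij_inj phib.
have E2 (u v : G) : phi @: [set u; v] = [set phi u; phi v].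
  by rewrite imsetU1 imset_set1.
have EE (e : {set G}) : (phi @: e \in edges G') = (e \in edges G).
  apply/edgeP/edgeP=> [[u [v [uv]]]|[u [v [uv ->]]]]; last first.
    by exists (phi u), (phi v); rewrite phia E2.
  case: phib => psi K1 K2; rewrite -(K2 u) -(K2 v) in uv *; rewrite -E2.
  by move/imset_inj => -> //; exists (psi u), (psi v); rewrite -phia.
have Eim : edges G' = [set phi @: (e : {set G}) | e in edges G].
  apply/setP => e'; apply/idP/imsetP => [e'E|[e eE ->]]; last by rewrite EE.
  have Ee : e' = phi @: (phi @^-1: e').
    case: phib => psi K1 K2; apply/setP => x; apply/idP/imsetP => [xe|[y]].
      by exists (psi x); rewrite ?inE K2.
    by rewrite inE => ? ->.
  by exists (phi @^-1: e'); rewrite // -EE -Ee.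
have Ec : #|edges G'| = #|edges G|.
  by rewrite Eim card_imset //; apply: imset_inj.
exists (fun e : {set G} => f (phi @: e)); split; first split.
- by move=> e eE; rewrite -Ec f1 ?EE.
- by move=> e e' eE e'E /f2; rewrite !EE => /(_ eE e'E)/imset_inj; apply.
- move=> c; rewrite -Ec => /f3[e']; rewrite Eim => /imsetP[e eE ->] ?.
  by exists e.
move=> u v Euv; apply/phii/fs; move: Euv.
have Es w : vertex_sum f (phi w) = vertex_sum (fun e : {set G} => f (phi @: e)) w.
  rewrite !vertex_sum_adj (reindex phi) /=; last exact: onW_bij.
  by apply: eq_big => [x|x _]; rewrite ?phia ?E2.
by rewrite !Es.
Qed.

(** * Labelings of a Cartesian product *)

Section Product.
Variables (G H : sgraph) (k l : nat).
Hypotheses (Gk : k_regular k G) (Hl : k_regular l H).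

Lemma cart_adjE (v v' : G) (u u' : H) :
  cart_adj (v, u) (v', u') =
  (v == v') && adj u u' || (u == u') && adj v v'.
Proof. by []. Qed.

Lemma big_cart_adj (F : G * H -> nat) (x : cart G H) :
  \sum_(y : cart G H | adj x y) F y =
  \sum_(v | adj x.1 v) F (v, x.2) + \sum_(u | adj x.2 u) F (x.1, u).
Proof.
case: x => v u /=; rewrite (bigID (fun y : G * H => y.2 == u)) /=; congr (_ + _).
- rewrite [RHS](reindex_onto (fun y : G * H => y.1) (fun w => (w, u))) //=.
  apply: eq_big => [[v' u']|[v' u'] /andP[_ /eqP/=->]] //.
  rewrite cart_adjE /= xpair_eqE eqxx /= [u' == u]eq_sym.
  by have [->|] := eqVneq u u'; rewrite ?adj_irrefl ?andbF ?andbT ?orFb.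
- rewrite [RHS](reindex_onto (fun y : G * H => y.2) (fun w => (v, w))) //=.
  apply: eq_big => [[v' u']|[v' u'] /andP[]] /=.
    rewrite cart_adjE /= xpair_eqE eqxx andbT /= [u' == u]eq_sym.
    have [<-|] := eqVneq u u'; first by rewrite adj_irrefl !andbF.
    by rewrite orbF andbT andbC.
  by rewrite /cart_adj /= [u' == u]eq_sym => /orP[/andP[/eqP-> _]|/andP[-> ]].
Qed.

Lemma cart_regular : k_regular (k + l) (cart G H).
Proof.
move=> x; rewrite /degree cardsE -sum1_card big_cart_adj.
by rewrite !sum1_card -(Gk x.1) -(Hl x.2) /degree !cardsE.
Qed.

Lemma cart_edge_cases (e : {set cart G H}) : e \in edges (cart G H) ->
  (exists2 eu : {set G} * H, eu.1 \in edges G & e = setX eu.1 [set eu.2]) \/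
  (exists2 vf : G * {set H}, vf.2 \in edges H & e = setX [set vf.1] vf.2).
Proof.
case/edgeP=> [[v u] [[v' u'] []]]; rewrite [adj _ _]cart_adjE => /orP[] /andP[/eqP <- a] ->.
- right; exists (v, [set u; u']); rewrite ?edge_adj //=.
  by apply/setP => -[x y]; rewrite !inE !xpair_eqE; case: (x == v).
- left; exists ([set v; v'], u); rewrite ?edge_adj //=.
  by apply/setP => -[x y]; rewrite !inE !xpair_eqE; case: (y == u); rewrite ?andbT ?andbF.
Qed.

(** Twice either side is [(k + l) * #|G| * #|H|], by the handshake identity for the product and for
    both factors. *)
Lemma cart_edges_card :
  #|edges (cart G H)| = #|edges G| * #|H| + #|G| * #|edges H|.
Proof.
have := handshake cart_regular; have := handshake Gk; have := handshake Hl.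
by rewrite card_prod; nia.
Qed.

(* Edges inside the copies of G get the labels below #|edges G| * #|H|, edges
   inside the copies of H the labels above. *)
Lemma antimagic_cart (lG : {set G} -> H -> nat) (lH : G -> {set H} -> nat) :
  (forall e u, e \in edges G -> lG e u < #|edges G| * #|H|) ->
  (forall e u e' u', e \in edges G -> e' \in edges G -> lG e u = lG e' u' ->
     e = e' /\ u = u') ->
  (forall v f, f \in edges H -> lH v f < #|G| * #|edges H|) ->
  (forall v f v' f', f \in edges H -> f' \in edges H -> lH v f = lH v' f' ->
     v = v' /\ f = f') ->
  (forall v u v' u', vertex_sum (lG^~ u) v + vertex_sum (lH v) u =
     vertex_sum (lG^~ u') v' + vertex_sum (lH v') u' -> v = v' /\ u = u') ->
  antimagic (cart G H).
Proof.
move=> lGlt lGinj lHlt lHinj sinj.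
(* An edge lies in a copy of [G] exactly when its projection to [H] is a single vertex. Each sum
   ranges over a singleton and only extracts its element. *)
pose F (e : {set cart G H}) :=
  let e1 := [set x.1 | x in e] in let e2 := [set x.2 | x in e] in
  if #|e2| == 1 then \sum_(u in e2) lG e1 u
  else #|edges G| * #|H| + \sum_(v in e1) lH v e2.
have im1 (A : {set G}) (B : {set H}) u : u \in B -> [set x.1 | x in setX A B] = A.
  move=> uB; apply/setP => x; apply/imsetP/idP => [[[a b] + ->]|xA].
    by rewrite !inE => /andP[].
  by exists (x, u); rewrite ?inE ?xA.
have im2 (A : {set G}) (B : {set H}) v : v \in A -> [set x.2 | x in setX A B] = B.
  move=> vA; apply/setP => x; apply/imsetP/idP => [[[a b] + ->]|xB].
    by rewrite !inE => /andP[].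
  by exists (v, x); rewrite ?inE ?xB ?vA.
have ne (K : sgraph) (e : {set K}) : e \in edges K -> exists x, x \in e.
  by move=> /edge_card ce; apply/card_gt0P; rewrite ce.
have FG e u : e \in edges G -> F (setX e [set u]) = lG e u.
  move=> /ne[v ve]; rewrite /F (im1 _ _ u) ?set11 // (im2 _ _ v) // cards1 eqxx.
  by rewrite big_set1.
have FH v f : f \in edges H ->
    F (setX [set v] f) = #|edges G| * #|H| + lH v f.
  move=> fE; have [u uf] := ne _ _ fE.
  by rewrite /F (im1 _ _ u) // (im2 _ _ v) ?set11 // (edge_card fE) big_set1.
apply: (antimagic_intro (f := F) cart_regular).
- move=> e /cart_edge_cases[][[x y] /= E ->]; rewrite cart_edges_card ?FG ?FH //.
  + exact: ltn_addr (lGlt _ _ E).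
  + by rewrite ltn_add2l lHlt.
- move=> e e' /cart_edge_cases[][[x y] /= E ->] /cart_edge_cases[][[x' y'] /= E' ->];
    rewrite ?FG ?FH //.
  + by case/(lGinj _ _ _ _ E E') => -> ->.
  + by have := lGlt _ y E; lia.
  + by have := lGlt _ y' E'; lia.
  + by move/addnI/(lHinj _ _ _ _ E E') => [-> ->].
(* The offset of the labels on copies of [H] occurs [l] times at every vertex, hence cancels. *)
- have sF x : vertex_sum F x =
      vertex_sum (lG^~ x.2) x.1 + vertex_sum (lH x.1) x.2
      + l * (#|edges G| * #|H|).
    rewrite -(vertex_sum_const (#|edges G| * #|H|) x.2 Hl) -addnA -vertex_sumD.
    rewrite !vertex_sum_adj big_cart_adj; case: x => v u /=.
    congr (_ + _); apply: eq_bigr => w a; rewrite -?FG ?[lH _ _ + _]addnC -?FH ?edge_adj //.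
      congr F; apply/setP => -[x y]; rewrite !inE !xpair_eqE.
      by case: (y == u); rewrite ?andbT ?andbF.
    by congr F; apply/setP => -[x y]; rewrite !inE !xpair_eqE; case: (x == v).
  by move=> [v u] [v' u']; rewrite !sF => /addIn/sinj/= [-> ->].
Qed.

End Product.

Lemma antimagic_cartC (G H : sgraph) : antimagic (cart G H) -> antimagic (cart H G).
Proof.
apply: (@antimagic_iso _ _ (fun x : cart H G => (x.2, x.1) : cart G H)).
  by exists (fun x : cart G H => (x.2, x.1) : cart H G) => -[].
by move=> [u v] [u' v']; rewrite [LHS]cart_adjE [RHS]cart_adjE orbC.
Qed.

(** * Mixed radix numbers, ranks and edge numberings *)

Lemma mixed_radix_inj (N a b c d : nat) :
  b < N -> d < N -> a * N + b = c * N + d -> a = c /\ b = d.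
Proof.
move=> bN dN E; have ac: a = c.
  have := congr1 (divn^~ N) E.
  by rewrite !divnMDl ?(leq_ltn_trans _ bN) // !divn_small // !addn0.
by split=> //; move: E; rewrite ac => /addnI.
Qed.

Lemma mixed_radix_lt (M N a b : nat) : a < M -> b < N -> a * N + b < M * N.
Proof. nia. Qed.

Lemma mixed_radix_le (N a b c d : nat) :
  d < N -> a * N + b < c * N + d -> a <= c.
Proof. by move=> dN; case: leqP => // ca; nia. Qed.

(** Ties of [s] are broken by [enum_rank], which makes the key [K] injective; the rank counts the
    elements with smaller key. *)
Lemma exists_rank (T : finType) (s : T -> nat) :
  exists p : T -> nat,
    [/\ forall x, p x < #|T|, injective p & forall x y, p x < p y -> s x <= s y].
Proof.
pose K x := s x * #|T| + enum_rank x.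
have Kinj : injective K.
  move=> x y E; apply/enum_rank_inj/val_inj => /=.
  by have [] := mixed_radix_inj (ltn_ord _) (ltn_ord _) E.
pose p x := #|[set y | K y < K x]|.
have pK x y : K x < K y -> p x < p y.
  move=> xy; apply: proper_card; apply/properP; split.
    by apply/subsetP => z; rewrite !inE; lia.
  by exists x; rewrite !inE ?ltnn.
exists p; split.
- move=> x; rewrite -cardsT; apply: proper_card; apply/properP; split=> //.
  by exists x; rewrite !inE ?ltnn.
- move=> x y E; apply: Kinj.
  by have [/pK|/pK|//] := ltngtP (K x) (K y); rewrite E ltnn.
- move=> x y xy; have : K x < K y.
    have [//|/pK|/Kinj E] := ltngtP (K x) (K y); last by rewrite E ltnn in xy.
    by move/(ltn_trans xy); rewrite ltnn.
  exact: mixed_radix_le (ltn_ord _).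
Qed.

Lemma edge_index (G : sgraph) : exists2 h : {set G} -> nat,
  {in edges G, forall e, h e < #|edges G|} & {in edges G &, injective h}.
Proof.
exists (fun e => index e (enum (edges G))).
  by move=> e eE; rewrite cardE index_mem mem_enum.
move=> e e' eE e'E /(congr1 (nth set0 (enum (edges G)))).
by rewrite !nth_index ?mem_enum.
Qed.

(** * Two-regular graphs *)

Section PartialSums.
Variable T : finType.
Implicit Types (A : {set {set T}}) (g : {set T} -> nat).

Definition deg_in A (v : T) := #|[set e in A | v \in e]|.
Definition sum_in A g (v : T) := \sum_(e in A | v \in e) g e.
(** Labels start at 0, so [#|A|] is the next free label once [A] is labelled. *)
Definition extend A g (e0 : {set T}) : {set T} -> nat :=
  fun e => if e == e0 then #|A| else g e.

Lemma deg_inU A e v : e \notin A -> deg_in (e |: A) v = (v \in e) + deg_in A v.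
Proof.
move=> eA; rewrite /deg_in !cardsE -!sum1_card !big_mkcondr /=.
by rewrite big_setU1 //=; case: (v \in e).
Qed.

Lemma sum_in_extend A g e v : e \notin A ->
  sum_in (e |: A) (extend A g e) v = (v \in e) * #|A| + sum_in A g v.
Proof.
move=> eA; rewrite /sum_in /extend !big_mkcondr /= big_setU1 //= eqxx.
congr (_ + _); first by case: (v \in e); rewrite ?mul1n.
by apply: eq_bigr => e' e'A; case: eqP => // E; rewrite -E e'A in eA.
Qed.

Lemma sum_in0 A g v : deg_in A v = 0 -> sum_in A g v = 0.
Proof.
move=> /eqP; rewrite cards_eq0 => /eqP E; apply: big1 => e /andP[eA ve].
have : e \in [set e in A | v \in e] by rewrite inE eA.
by rewrite E inE.
Qed.

End PartialSums.

Lemma deg_in_edges (G : sgraph) k v : k_regular k G -> deg_in (edges G) v = k.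
Proof.
move=> Gk; rewrite -[RHS]muln1 -(vertex_sum_const 1 v Gk) /vertex_sum sum1_card.
by rewrite /deg_in cardsE.
Qed.

Section TwoRegular.
Variable G : sgraph.
Hypothesis G2 : k_regular 2 G.
Implicit Types (A : {set {set G}}) (g : {set G} -> nat).

Lemma deg_in_le A v : A \subset edges G -> deg_in A v <= 2.
Proof.
move=> AE; rewrite -(deg_in_edges v G2); apply/subset_leq_card/subsetP => e.
by rewrite !inE => /andP[/(subsetP AE)]; rewrite inE => -> ->.
Qed.

Lemma exists_free_edge A v : A \subset edges G -> deg_in A v < 2 ->
  exists w, adj v w /\ [set v; w] \notin A.
Proof.
move=> AE dv; case: (pickP [pred w | adj v w && ([set v; w] \notin A)]).
  by move=> w /andP[]; exists w.
move=> none; suff : 2 <= deg_in A v by rewrite leqNgt dv.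
rewrite -(deg_in_edges v G2); apply/subset_leq_card/subsetP => e.
rewrite inE => /andP[eE ve]; rewrite inE ve andbT.
have /edgeP[a [b [ab Ee]]] := eE.
move: ve; rewrite Ee !inE => /orP[]/eqP Ev.
  by have /negbT := none b; rewrite /= Ev ab negbK.
by have /negbT := none a; rewrite /= Ev adj_sym ab negbK setUC.
Qed.

(* Labels are given out in increasing order, growing alternately at its two ends
   [x] and [y] a path whose newest end is [x]; the saturated vertices then get
   increasing sums. *)
Definition closed_state A g :=
  (forall v, deg_in A v = 0 \/ deg_in A v = 2) /\
  (forall v, deg_in A v = 2 -> sum_in A g v + 3 <= 2 * #|A|).

(** The single edge at [x] has the last label [#|A| - 1]. The ends can tie only while the path is
    one edge. The last clause says that [y], saturated by the next label [#|A|], will exceed all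
    saturated vertices. *)
Definition open_state A g (x y : G) :=
  [/\ x != y /\ (deg_in A x = 1 /\ deg_in A y = 1),
      forall v, v != x -> v != y -> deg_in A v = 0 \/ deg_in A v = 2,
      sum_in A g x + 1 = #|A|,
      sum_in A g y <= sum_in A g x /\
        (sum_in A g y = sum_in A g x -> [set y; x] \in A)
    & forall v, deg_in A v = 2 -> sum_in A g v < sum_in A g y + #|A|].

Definition greedy_state A g :=
  [/\ A \subset edges G, {in A, forall e, g e < #|A|}, {in A &, injective g},
      forall v w, deg_in A v = 2 -> deg_in A w = 2 ->
        sum_in A g v = sum_in A g w -> v = w
    & closed_state A g \/ exists x y, open_state A g x y].

(** In a closed state any free edge starts a new path. In an open state the path grows at [y],
    either to a fresh vertex or to [x], closing a cycle. Each newly saturated vertex gets a sum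
    above all earlier ones. *)
Lemma greedy_step A g : greedy_state A g -> A != edges G ->
  exists e, e \notin A /\ greedy_state (e |: A) (extend A g e).
Proof.
move=> [AE glt ginj dist st] AnE.
have common e : e \in edges G -> e \notin A ->
    [/\ e |: A \subset edges G,
        {in e |: A, forall e', extend A g e e' < #|e |: A|}
      & {in e |: A &, injective (extend A g e)}].
  move=> eE eA; split.
  - by rewrite subUset sub1set eE.
  - move=> e' /setU1P[->|/glt]; rewrite /extend cardsU1 eA ?eqxx //.
    by case: eqP => _; clear; lia.
  - move=> a b /setU1P[->|aA] /setU1P[->|bA] //; rewrite /extend ?eqxx.
    + by case: eqP => // _ E; have := glt _ bA; rewrite -E ltnn.
    + by case: eqP => // _ E; have := glt _ aA; rewrite E ltnn.
    + case: eqP => [Ea|_]; first by rewrite -Ea aA in eA.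
      case: eqP => [Eb|_]; first by rewrite -Eb bA in eA.
      exact: ginj.
have fits a b : adj a b -> [set a; b] \notin A -> deg_in A b < 2.
  move=> ab abA; have eE : [set a; b] \in edges G by rewrite edge_adj.
  have [s _ _] := common _ eE abA.
  by have := deg_in_le b s; rewrite deg_inU // set22.
case: st => [[d02 sle]|[x [y [[xy [dx dy]] d02 sx [syx syxA] slt]]]].
- have [a [b [ab abA]]] : exists a b, adj a b /\ [set a; b] \notin A.
    have /subsetPn[e /edgeP[a [b [ab ->]]] eA] : ~~ (edges G \subset A).
      by apply: contra AnE => EA; rewrite eqEsubset AE.
    by exists a, b.
  have eE : [set a; b] \in edges G by rewrite edge_adj.
  have [c1 c2 c3] := common _ eE abA.
  have db : deg_in A b = 0 by have := fits _ _ ab abA; have := d02 b; clear; lia.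
  have da : deg_in A a = 0.
    have := fits b a; rewrite adj_sym setUC => /(_ ab abA); have := d02 a; clear; lia.
  have ndeg v : deg_in ([set a; b] |: A) v = 2 -> deg_in A v = 2 /\ v \notin [set a; b].
    rewrite deg_inU // !inE; have [->|_] := eqVneq v a; first by rewrite da.
    by have [->|_] := eqVneq v b; rewrite ?db // orbF.
  exists [set a; b]; split=> //; split=> //.
    move=> v w /ndeg[dv nv] /ndeg[dw nw]; rewrite !sum_in_extend // (negPf nv) (negPf nw).
    exact: dist.
  right; exists a, b; split; rewrite ?deg_inU ?sum_in_extend ?set21 ?set22 ?da ?db //.
  + by rewrite (adj_neq ab).
  + by move=> v va vb; rewrite deg_inU // !inE (negPf va) (negPf vb); apply: d02.
  + by rewrite cardsU1 abA sum_in0 //; clear; lia.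
  + by rewrite !sum_in0 // setUC setU11.
  + move=> v /ndeg[dv nv]; rewrite !sum_in_extend // (negPf nv) cardsU1 abA.
    have := sle v dv; clear; lia.
- have [z [yz yzA]] : exists z, adj y z /\ [set y; z] \notin A.
    by apply: exists_free_edge; rewrite // dy.
  have eE : [set y; z] \in edges G by rewrite edge_adj.
  have [c1 c2 c3] := common _ eE yzA.
  exists [set y; z]; split=> //.
  have yx : (y == x) = false by rewrite eq_sym (negPf xy).
  have zy : (z == y) = false by rewrite eq_sym (negPf (adj_neq yz)).
  have [Ezx|zx] := eqVneq z x.
  + rewrite {z}Ezx in yz yzA eE c1 c2 c3 zy *.
    (* Closing the cycle saturates both ends with the same new label, so their old sums must differ;
       a tie would mean that the closing edge is already used. *)
    have syx' : sum_in A g y < sum_in A g x.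
      by rewrite ltn_neqAle syx andbT; apply: contra yzA => /eqP/syxA.
    have dU v : deg_in ([set y; x] |: A) v = 2 -> [\/ v = y, v = x | deg_in A v = 2 /\ v \notin [set y; x]].
      rewrite deg_inU // !inE; have [->|_] := eqVneq v y; first by constructor 1.
      by have [->|_] := eqVneq v x; [constructor 2|constructor 3].
    have sU := sum_in_extend g _ yzA.
    split=> //; last first.
      left; split=> v.
        rewrite deg_inU // !inE; have [->|vy] := eqVneq v y; first by rewrite dy; right.
        have [->|vx] := eqVneq v x; first by rewrite dx; right.
        exact: d02.
      rewrite sU cardsU1 yzA; case/dU => [->|->|[dv nv]].
      * by rewrite set21; clear -sx syx'; lia.
      * by rewrite set22; clear -sx syx'; lia.
      * by rewrite (negPf nv); have := slt v dv; clear -sx syx'; lia.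
    move=> v w /dU dv /dU dw; rewrite !sU.
    case: dv => [->|->|[dv nv]]; case: dw => [->|->|[dw nw]] //;
      rewrite ?set21 ?set22 ?(negPf nv) ?(negPf nw).
    * by clear -sx syx'; lia.
    * by have := slt _ dw; clear -sx syx'; lia.
    * by clear -sx syx'; lia.
    * by have := slt _ dw; clear -sx syx'; lia.
    * by have := slt _ dv; clear -sx syx'; lia.
    * by have := slt _ dv; clear -sx syx'; lia.
    * exact: dist.
  + have dz : deg_in A z = 0.
      have := fits _ _ yz yzA; have := d02 z zx; rewrite zy => /(_ isT); clear; lia.
    have sz := sum_in0 g dz.
    have dU v : deg_in ([set y; z] |: A) v = 2 -> v = y \/ deg_in A v = 2 /\ v \notin [set y; z].
      rewrite deg_inU // !inE; have [->|_] := eqVneq v y; first by left.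
      by have [->|_] := eqVneq v z; [rewrite dz|right].
    have sU := sum_in_extend g _ yzA.
    have nx : (x \in [set y; z]) = false by rewrite !inE eq_sym yx eq_sym (negPf zx).
    split=> //.
      move=> v w /dU dv /dU dw; rewrite !sU.
      case: dv => [->|[dv nv]]; case: dw => [->|[dw nw]] //;
        rewrite ?set21 ?set22 ?(negPf nv) ?(negPf nw).
      * by have := slt _ dw; clear; lia.
      * by have := slt _ dv; clear; lia.
      * exact: dist.
    (* The ends swap roles: [z] is the newest end, and the path grows next at [x]. *)
    right; exists z, x; split; rewrite ?deg_inU ?sU ?nx ?set22 ?dz ?dx //.
    * move=> v vz vx; rewrite deg_inU // !inE (negPf vz) orbF.
      have [->|vy] := eqVneq v y; first by rewrite dy; right.
      exact: d02.
    * by rewrite cardsU1 yzA sz; clear -sx; lia.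
    * by rewrite sz; clear -sx; lia.
    * move=> v; rewrite !sU ?nx cardsU1 yzA => /dU[->|[dv nv]].
        by rewrite set21; clear -sx syx; lia.
      by rewrite (negPf nv); have := slt v dv; clear -sx syx; lia.
Qed.

(** Greedy steps lead from the empty set to all edges; then every vertex is saturated, and
    distinctness of saturated sums is injectivity. *)
Lemma two_regular_labeling : exists g : {set G} -> nat,
  [/\ {in edges G, forall e, g e < #|edges G|}, {in edges G &, injective g}
    & injective (vertex_sum g)].
Proof.
have loop n A g : #|edges G| - #|A| = n -> greedy_state A g ->
    exists g', greedy_state (edges G) g'.
  elim: n A g => [|n IH] A g En st; have [AE _ _ _ _] := st.
    have /eqP EA : A == edges G by rewrite eqEcard AE; lia.
    by exists g; rewrite -EA.
  have AnE : A != edges G by apply: contra_eqN En => /eqP->; rewrite subnn.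
  have [e [eA st']] := greedy_step st AnE.
  by apply: IH st'; rewrite cardsU1 eA; lia.
have [|g [_ glt ginj dist _]] := loop _ set0 (fun=> 0) erefl.
  have d0 v : deg_in set0 v = 0 :> nat.
    by apply: eq_card0 => e; rewrite !inE.
  split=> [|e|e|v w|]; rewrite ?sub0set ?inE ?d0 //.
  by left; split=> v; rewrite d0 //; left.
by exists g; split=> // v w; apply: dist; rewrite (deg_in_edges _ G2).
Qed.

Lemma two_regular_antimagic : antimagic G.
Proof.
by have [g [glt ginj sinj]] := two_regular_labeling; apply: (antimagic_intro G2 glt).
Qed.

End TwoRegular.

(** * Products with explicit blocks *)

Lemma vertex_sum_le (G : sgraph) k (g : {set G} -> nat) v : k_regular k G ->
  {in edges G, forall e, g e < #|edges G|} ->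
  vertex_sum g v <= k * #|edges G|.-1.
Proof.
move=> Gk glt; rewrite -(vertex_sum_const _ v Gk); apply: leq_sum => e /andP[eE _].
by have := glt e eE; lia.
Qed.

Section Cases.
Variables (G H : sgraph) (k l : nat).
Hypotheses (Gk : k_regular k G) (Hl : k_regular l H).

(* The copies of [G] get consecutive blocks of labels, and so do the parallel
   copies of each edge of [H]. *)
Lemma antimagic_cart_narrow (g : {set G} -> nat) : 0 < l ->
  {in edges G, forall e, g e < #|edges G|} -> {in edges G &, injective g} ->
  (forall v v', vertex_sum g v + l * #|G|.-1 < vertex_sum g v' + k * #|edges G|) ->
  antimagic (cart G H).
Proof.
move=> l0 glt ginj narrow; have [h hlt hinj] := edge_index H.
have [p [plt pinj ps]] := exists_rank (vertex_sum g).
have [q [qlt qinj qt]] := exists_rank (vertex_sum h).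
apply: (antimagic_cart (lG := fun e u => q u * #|edges G| + g e)
          (lH := fun v f => #|G| * h f + p v) Gk Hl).
- by move=> e u eE; rewrite [ltnRHS]mulnC mixed_radix_lt ?glt.
- move=> e u e' u' eE e'E /(mixed_radix_inj (glt e eE) (glt e' e'E))[/qinj-> /ginj->] //.
- by move=> v f fE; rewrite mulnC [ltnRHS]mulnC mixed_radix_lt ?hlt.
- move=> v f v' f' fE f'E; rewrite !(mulnC #|G|).
  by case/(mixed_radix_inj (plt v) (plt v')) => /hinj-> // /pinj->.
(* A copy of higher rank gains at least [k * #|edges G|] from its block and loses nothing in the sum
   of [h]; [narrow] bounds what the other terms can lose. *)
have main v u v' u' : q u < q u' ->
    vertex_sum g v + k * (q u * #|edges G|) + (#|G| * vertex_sum h u + l * p v)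
    < vertex_sum g v' + k * (q u' * #|edges G|) + (#|G| * vertex_sum h u' + l * p v').
  move=> qq; have := qt _ _ qq; have := narrow v v'.
  have : l * p v <= l * #|G|.-1 by rewrite leq_mul2l; have := plt v; lia.
  have : k * (q u * #|edges G|) + k * #|edges G| <= k * (q u' * #|edges G|).
    by rewrite -mulnDr leq_mul2l -mulSnr leq_mul2r qq !orbT.
  by move=> + + + /(leq_mul (leqnn #|G|)); lia.
move=> v u v' u'; rewrite !vertex_sumD !(vertex_sum_const _ _ Gk).
rewrite !(vertex_sum_const _ _ Hl) !vertex_sumZ !(addnC (k * _)) => E.
have Eu : u = u'.
  apply: qinj; have [lt|lt|//] := ltngtP (q u) (q u').
    by have := main v _ v' _ lt; rewrite E ltnn.
  by have := main v' _ v _ lt; rewrite E ltnn.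
(* Within one copy the sum of [g] is nondecreasing in the rank, and [l * p] strictly increasing. *)
split=> //; subst u'; apply: pinj; have [lt|lt|//] := ltngtP (p v) (p v').
  have := ps _ _ lt; have : l * p v < l * p v' by rewrite ltn_pmul2l.
  by clear -E; lia.
have := ps _ _ lt; have : l * p v' < l * p v by rewrite ltn_pmul2l.
by clear -E; lia.
Qed.

End Cases.

(** * Products of a 2-regular graph with a 1-regular or 2-regular graph *)

Section SmallCases.
Variables G H : sgraph.
Hypothesis G2 : k_regular 2 G.

(* The two copies of [G] joined by an edge of [H] share a block of labels,
   split between them by parity. *)
Lemma antimagic_cart21 : k_regular 1 H -> antimagic (cart G H).
Proof.
move=> H1; have [h hlt hinj] := edge_index H.
have [g [glt ginj sinj]] := two_regular_labeling G2.
have [p [plt pinj ps]] := exists_rank (vertex_sum g).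
have nbr u : exists w, adj u w /\ vertex_sum h u = h [set u; w] /\
    forall w', adj u w' -> w' = w.
  have /eqP/cards1P[w Ew] := H1 u; have adjE w' : adj u w' = (w' == w).
    by move/setP/(_ w'): Ew; rewrite !inE.
  exists w; rewrite adjE eqxx; split=> //; split; last by move=> w'; rewrite adjE => /eqP.
  by rewrite vertex_sum_adj (big_pred1 w).
(* The sum of [h] at [u] is the label of the only edge there, and [side] tells its two ends
   apart. *)
pose side u := [exists w : H, adj u w && (enum_rank u < enum_rank w)].
have uinj u u' : vertex_sum h u = vertex_sum h u' -> side u = side u' -> u = u'.
  have [w [uw [-> uu]]] := nbr u; have [w' [uw' [-> uu']]] := nbr u'.
  move=> /hinj; rewrite !edge_adj => /(_ uw uw')/eq_set2[[]//|[E1 E2]].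
  subst w w'; have sideE x y : adj x y -> (forall z, adj x z -> z = y) ->
      side x = (enum_rank x < enum_rank y).
    move=> xy xz; apply/existsP/idP => [[z /andP[/xz->//]]|?].
    by exists y; rewrite xy.
  rewrite (sideE _ _ uw uu) (sideE _ _ uw' uu').
  have [//|//|/val_inj/enum_rank_inj//] := ltngtP (enum_rank u) (enum_rank u').
have tlt u : vertex_sum h u < #|edges H|.
  by have [w [uw [-> _]]] := nbr u; rewrite hlt ?edge_adj.
have EH := handshake H1; have EG := handshake G2.
have glt2 e u : e \in edges G -> 2 * g e + side u < 2 * #|edges G|.
  by move=> /glt; case: (side u); lia.
apply: (antimagic_cart
          (lG := fun e u => vertex_sum h u * (2 * #|edges G|) + (2 * g e + side u))
          (lH := fun v f => #|G| * h f + p v) G2 H1).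
- move=> e u eE; have -> : #|edges G| * #|H| = #|edges H| * (2 * #|edges G|).
    by rewrite -[#|H|]mul1n -EH; clear; lia.
  exact: mixed_radix_lt (tlt u) (glt2 e u eE).
- move=> e u e' u' eE e'E /(mixed_radix_inj (glt2 e u eE) (glt2 e' u' e'E))[Et Eg].
  have Es : side u = side u' by move: Eg; do 2 case: (side _) => //; lia.
  split; last exact: uinj.
  by apply: ginj => //; move: Eg; rewrite Es; lia.
- by move=> v f fE; rewrite mulnC [ltnRHS]mulnC mixed_radix_lt ?hlt.
- move=> v f v' f' fE f'E; rewrite !(mulnC #|G|).
  by case/(mixed_radix_inj (plt v) (plt v')) => /hinj-> // /pinj->.
move=> v u v' u'; rewrite !vertex_sumD !(vertex_sum_const _ _ G2).
rewrite !(vertex_sum_const _ _ H1) !vertex_sumZ => E.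
have bound x y : 2 * vertex_sum g x + 2 * side y + p x < 4 * #|edges G| + #|G|.
  have := vertex_sum_le x G2 glt; have := plt x; case: (side y); lia.
(* The total is a number in base [4 * #|edges G| + #|G|] whose leading digit is the label of the
   edge of [H]. *)
have [Et Er] : vertex_sum h u = vertex_sum h u' /\
    2 * vertex_sum g v + 2 * side u + p v = 2 * vertex_sum g v' + 2 * side u' + p v'.
  by apply: mixed_radix_inj (bound v u) (bound v' u') _; lia.
(* A higher rank raises the sum of [g] by at least 1, hence the remainder by at least 3, while
   [side] changes it by at most 2. *)
have Ev : v = v'.
  apply: pinj; have [lt|lt|//] := ltngtP (p v) (p v').
    have := ps _ _ lt; rewrite leq_eqVlt => /orP[/eqP/sinj Ev|]; first by rewrite Ev ltnn in lt.
    by move: Er; do 2 case: (side _); lia.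
  have := ps _ _ lt; rewrite leq_eqVlt => /orP[/eqP/sinj Ev|]; first by rewrite Ev ltnn in lt.
  by move: Er; do 2 case: (side _); lia.
split=> //; apply: uinj => //; move: Er; rewrite Ev.
by do 2 case: (side _) => //; lia.
Qed.

(* Copies of an edge of [H] with odd label are labelled in reverse, so that at a
   vertex with odd sum in [H] the two [H]-edges contribute a constant. *)
Lemma antimagic_cart22 : k_regular 2 H -> antimagic (cart G H).
Proof.
move=> H2.
have [g [glt ginj sinj]] := two_regular_labeling G2.
have [h [hlt hinj tinj]] := two_regular_labeling H2.
have [p [plt pinj ps]] := exists_rank (vertex_sum g).
have [q [qlt qinj qt]] := exists_rank (vertex_sum h).
pose n := #|G|; have En : #|edges G| = n by have := handshake G2; rewrite -/n; lia.
(* The number of odd-labelled edges at [u]; it has the parity of the sum of [h]. *)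
pose o u := vertex_sum (fun f => odd (h f) : nat) u.
have Et u : vertex_sum h u = o u + 2 * vertex_sum (fun f => (h f)./2) u.
  rewrite -vertex_sumZ -vertex_sumD; apply: eq_vertex_sum => f _ _.
  by rewrite mul2n odd_double_half.
have oc u : vertex_sum (fun f => ~~ odd (h f) : nat) u + o u = 2.
  rewrite -[RHS](vertex_sum_const 1 u H2) -vertex_sumD; apply: eq_vertex_sum => f _ _.
  by case: (odd _).
(* If both [H]-edges at [u] are reversed, their contribution decreases in [p]; reversing the copy of
   [G] as well makes the whole sum decrease. *)
pose r u e := if o u == 2 then n.-1 - g e else g e.
pose pp v f := if odd (h f) then n.-1 - p v else p v.
have rlt u e : e \in edges G -> r u e < n.
  by move=> /glt; rewrite /r En; case: ifP; lia.
have pplt v f : pp v f < n by have := plt v; rewrite /pp -/n; case: ifP; lia.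
apply: (antimagic_cart (lG := fun e u => q u * #|edges G| + r u e)
          (lH := fun v f => #|G| * h f + pp v f) G2 H2); rewrite -?/n ?En.
- by move=> e u eE; rewrite [ltnRHS]mulnC mixed_radix_lt ?rlt.
- move=> e u e' u' eE e'E /(mixed_radix_inj (rlt u e eE) (rlt u' e' e'E))[/qinj-> Er].
  split=> //; apply: ginj => //; move: Er (glt e eE) (glt e' e'E).
  by rewrite /r En; case: ifP; lia.
- by move=> v f fE; rewrite mulnC [ltnRHS]mulnC mixed_radix_lt ?hlt.
- move=> v f v' f' fE f'E; rewrite !(mulnC n).
  case/(mixed_radix_inj (pplt v f) (pplt v' f')) => /hinj-> // Ep.
  split=> //; apply: pinj; move: Ep (plt v) (plt v').
  by rewrite /pp -/n; case: ifP; lia.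
have sr u v : vertex_sum (r u) v =
    if o u == 2 then 2 * n.-1 - vertex_sum g v else vertex_sum g v.
  rewrite /r; case: ifP => // _; rewrite -(vertex_sum_const n.-1 v G2).
  rewrite -[LHS](addnK (vertex_sum g v)) -vertex_sumD; congr (_ - _).
  by apply: eq_vertex_sum => e /glt; rewrite En; lia.
have sp u v : vertex_sum (pp v) u = o u * (n.-1 - p v) + (2 - o u) * p v.
  have -> : 2 - o u = vertex_sum (fun f => ~~ odd (h f) : nat) u by have := oc u; lia.
  rewrite !(mulnC _ (n.-1 - _)) !(mulnC _ (p v)) -!vertex_sumZ -vertex_sumD.
  by apply: eq_vertex_sum => f _ _; rewrite /pp; case: ifP; rewrite ?muln0 ?muln1 ?addn0.
have sle v : vertex_sum g v <= 2 * n.-1 by rewrite -En; apply: vertex_sum_le G2 glt.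
have ple v : p v <= n.-1 by have := plt v; rewrite -/n; lia.
have o2 u : o u <= 2 by have := oc u; lia.
pose T v u := 2 * (q u * n) + vertex_sum (r u) v + (n * vertex_sum h u + vertex_sum (pp v) u).
have main v u v' u' : q u < q u' -> T v u < T v' u'.
  move=> qq; have := qt _ _ qq; rewrite leq_eqVlt => /orP[/eqP/tinj E|tt].
    by rewrite E ltnn in qq.
  have n0 : 0 < n by apply/card_gt0P; exists v.
  have : q u * n + n <= q u' * n by rewrite -mulSnr leq_mul2r qq orbT.
  have t1 : n * vertex_sum h u + n <= n * vertex_sum h u'.
    by rewrite -mulnSr leq_mul2l tt orbT.
  (* Otherwise both sums of [h] are even, so they differ by at least 2. This absorbs a loss of up to
     [2 * n.-1] in the [pp] terms; if [o] is 1 on one side, the loss is at most [n.-1]. *)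
  have t2 : o u = 1 \/ o u' = 1 \/ n * vertex_sum h u + 2 * n <= n * vertex_sum h u'.
    have [E|E] := ltnP (vertex_sum h u + 1) (vertex_sum h u').
      by right; right; rewrite [2 * n]mulnC -mulnDr leq_mul2l; lia.
    by move: E tt (o2 u) (o2 u'); rewrite !Et; lia.
  move: t1 t2 (sle v) (sle v') (ple v) (ple v').
  rewrite /T !sr !sp; case: (o u) (o2 u) => [|[|[|//]]] _;
  case: (o u') (o2 u') => [|[|[|//]]] _ /=; lia.
move=> v u v' u'; rewrite !vertex_sumD !(vertex_sum_const _ _ G2) !vertex_sumZ.
rewrite -/(T v u) -/(T v' u') => E.
have Eu : u = u'.
  apply: qinj; have [lt|lt|//] := ltngtP (q u) (q u').
    by have := main v _ v' _ lt; rewrite E ltnn.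
  by have := main v' _ v _ lt; rewrite E ltnn.
split=> //; subst u'; apply: pinj.
(* Strictness is essential when [o u = 1], where the [H]-edges contribute a constant. *)
have pinc x y : p x < p y -> vertex_sum g x < vertex_sum g y.
  move=> lt; have := ps _ _ lt; rewrite leq_eqVlt => /orP[/eqP/sinj Exy|//].
  by rewrite Exy ltnn in lt.
move: E (sle v) (sle v') (ple v) (ple v').
have [lt|lt|//] := ltngtP (p v) (p v'); have := pinc _ _ lt; rewrite /T !sr !sp;
  case: (o u) (o2 u) => [|[|[|//]]] _ /=; lia.
Qed.

End SmallCases.

Lemma antimagic_cart11 (G H : sgraph) :
  k_regular 1 G -> k_regular 1 H -> antimagic (cart G H).
Proof. by move=> G1 H1; apply/two_regular_antimagic/(cart_regular G1 H1). Qed.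

(** * Trail decompositions *)

Section Trails.
Variable T : finType.
Implicit Types (F : {set {set T}}) (x y z v : T) (p : seq T) (Ts : seq (T * seq T)).

Fixpoint walk_edges x p : seq {set T} :=
  if p is y :: p' then [set x; y] :: walk_edges y p' else [::].

Lemma walk_edges_cat x p q :
  walk_edges x (p ++ q) = walk_edges x p ++ walk_edges (last x p) q.
Proof. by elim: p x => //= y p IH x; rewrite IH. Qed.

(** Each edge is removed once used, so no edge repeats. *)
Fixpoint trail F x p :=
  if p is y :: p' then
    [&& x != y, [set x; y] \in F & trail (F :\ [set x; y]) y p']
  else true.

Fixpoint leftover F x p :=
  if p is y :: p' then leftover (F :\ [set x; y]) y p' else F.

Lemma leftover_sub F x p : leftover F x p \subset F.
Proof.
elim: p F x => //= y p IH F x.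
exact: subset_trans (IH _ _) (subD1set _ _).
Qed.

Lemma leftover_lt F x p : trail F x p -> p != [::] -> #|leftover F x p| < #|F|.
Proof.
case: p => //= y p /and3P[_ eF _] _; rewrite [ltnRHS](cardsD1 [set x; y]) eF.
exact: subset_leq_card (leftover_sub _ _ _).
Qed.

Lemma trail_perm F x p : trail F x p ->
  perm_eq (enum F) (walk_edges x p ++ enum (leftover F x p)).
Proof.
elim: p F x => [|y p IH] F x //= /and3P[_ eF /IH]; rewrite -(perm_cons [set x; y]).
apply: perm_trans; apply: uniq_perm; rewrite /= ?enum_uniq ?andbT //.
  by rewrite mem_enum !inE eqxx.
by move=> e; rewrite inE !mem_enum !inE; have [->|] := eqVneq e [set x; y].
Qed.

Lemma deg_inD1 F e v : e \in F -> deg_in F v = (v \in e) + deg_in (F :\ e) v.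
Proof. by move=> eF; rewrite -deg_inU ?setD11 // setD1K. Qed.

(** Passing through a vertex uses two edges, so only the ends change parity; they cancel if they
    coincide. *)
Lemma trail_parity F x p v : trail F x p ->
  odd (deg_in (leftover F x p) v) = odd (deg_in F v) (+) (v == x) (+) (v == last x p).
Proof.
elim: p F x => [|y p IH] F x /=; first by rewrite -addbA addbb addbF.
case/and3P=> xy eF /IH ->; rewrite (deg_inD1 v eF) oddD !inE.
congr (_ (+) _); have [->|vx] := eqVneq v x.
  by rewrite (negPf xy) /= addbF addbT negbK.
by case: (v == y) => /=; rewrite ?addbF ?addbT ?negbK.
Qed.

Definition simple F := forall e, e \in F -> #|e| = 2.

Lemma simple_sub F F' : F' \subset F -> simple F -> simple F'.
Proof. by move=> /subsetP sF sim e /sF; apply: sim. Qed.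

Lemma simple_other F e x : simple F -> e \in F -> x \in e ->
  exists2 y, x != y & e = [set x; y].
Proof.
move=> sim eF; have /eqP/cards2P[a [b [ab ->]]] := sim e eF.
rewrite !inE => /orP[]/eqP->; first by exists b.
by exists a; rewrite 1?eq_sym // setUC.
Qed.

(** Follow an edge from [x] to [z]. If [z] is even, removing that edge makes [z] odd and [x] even,
    so a trail continued from [z] ends at an odd vertex other than both. *)
Lemma odd_trail F x : simple F -> odd (deg_in F x) ->
  exists p, [/\ trail F x p, odd (deg_in F (last x p)) & last x p != x].
Proof.
have [n] := ubnP #|F|; elim: n F x => // n IH F x lt sim ox.
have /card_gt0P[e] : 0 < deg_in F x by case: deg_in ox.
rewrite inE => /andP[eF xe]; have [z xz Ee] := simple_other sim eF xe.
have [oz|ez] := boolP (odd (deg_in F z)).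
  by exists [:: z] => /=; rewrite xz -Ee eF eq_sym xz.
have oF v : odd (deg_in F v) = (v \in e) (+) odd (deg_in (F :\ e) v).
  by rewrite (deg_inD1 v eF) oddD; case: (v \in e).
have [|||p [tr olast lastz]] := IH (F :\ e) z.
- by move: lt; rewrite (cardsD1 e F) eF.
- exact: simple_sub (subD1set _ _) sim.
- by move: ez; rewrite oF Ee set22 /= negbK.
have lastx : last z p != x.
  by apply: contraTneq olast => ->; move: ox; rewrite oF Ee set21.
exists (z :: p); rewrite /= xz -Ee eF tr lastx; split=> //.
by rewrite oF olast Ee !inE (negPf lastx) (negPf lastz).
Qed.

(** Without one edge, its ends are the only odd vertices, so an odd trail from one must reach the
    other. *)
Lemma closed_trail F : simple F -> (forall v, ~~ odd (deg_in F v)) -> F != set0 ->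
  exists x p, [/\ trail F x p, last x p = x & p != [::]].
Proof.
move=> sim even /set0Pn[e eF].
have /card_gt0P[x xe] : 0 < #|e| by rewrite sim.
have [z xz Ee] := simple_other sim eF xe.
have oF v : odd (deg_in (F :\ e) v) = (v \in e).
  by have := even v; rewrite (deg_inD1 v eF) oddD; case: (v \in e) => /=; case: odd.
have [||p [tr olast lastz]] := @odd_trail (F :\ e) z.
- exact: simple_sub (subD1set _ _) sim.
- by rewrite oF Ee set22.
exists x, (z :: p); rewrite /= xz -Ee eF tr; split=> //.
by move: olast; rewrite oF Ee !inE (negPf lastz) orbF => /eqP.
Qed.

Definition trails_edges Ts := flatten [seq walk_edges t.1 t.2 | t <- Ts].

(** A trail without edges counts twice at its vertex. *)
Definition ends Ts v := \sum_(t <- Ts) ((t.1 == v) + (last t.1 t.2 == v)).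

(** Each extracted trail joins two odd vertices and makes both even, so every odd vertex is an end
    once. *)
Lemma odd_decomposition F : simple F -> exists Ts F',
  [/\ simple F', forall v, ~~ odd (deg_in F' v),
      forall v, ends Ts v = odd (deg_in F v)
    & perm_eq (enum F) (trails_edges Ts ++ enum F')].
Proof.
have [n] := ubnP #|F|; elim: n F => // n IH F lt sim.
case: (pickP [pred v | odd (deg_in F v)]) => [x /= ox|even]; last first.
  exists [::], F; split=> // v; rewrite /ends ?big_nil.
  - by have /= -> := even v.
  - by have /= -> := even v.
have [p [tr ol lx]] := odd_trail sim ox.
have [||Ts [F' [sim' even' Ets perm]]] := IH (leftover F x p).
- by apply: leq_trans (leftover_lt tr _) lt; case: p lx {tr ol}; rewrite //= eqxx.
- exact: simple_sub (leftover_sub _ _ _) sim.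
exists ((x, p) :: Ts), F'; split=> //; last first.
  apply: perm_trans (trail_perm tr) _.
  by rewrite /trails_edges /= -catA perm_cat2l.
move=> v; have := Ets v; rewrite /ends big_cons => -> /=; rewrite trail_parity //.
have [->|xv] := eqVneq v x; first by rewrite (negPf lx) ox [x == _]eq_sym (negPf lx).
by have [->|_] := eqVneq v (last x p); rewrite ?ol ?addbF.
Qed.

(* A closed trail through an end of a trail can be spliced into that trail. *)
Lemma splice_decomposition F Ts : simple F -> (forall v, ~~ odd (deg_in F v)) ->
  (forall v, 0 < ends Ts v) -> exists Ts',
  (forall v, ends Ts' v = ends Ts v) /\
  perm_eq (trails_edges Ts ++ enum F) (trails_edges Ts').
Proof.
have [n] := ubnP #|F|; elim: n F Ts => // n IH F Ts lt sim even pos.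
have [->|ne] := eqVneq F set0.
  by exists Ts; rewrite enum_set0 cats0.
have [x [p [tr lx pn]]] := closed_trail sim even ne.
suff [Ts1 [E1 P1]] : exists Ts1, (forall v, ends Ts1 v = ends Ts v) /\
    perm_eq (trails_edges Ts ++ walk_edges x p) (trails_edges Ts1).
  have [||||Ts' [E' P']] := IH (leftover F x p) Ts1.
  - exact: leq_trans (leftover_lt tr pn) lt.
  - exact: simple_sub (leftover_sub _ _ _) sim.
  - by move=> v; rewrite trail_parity // lx -addbA addbb addbF.
  - by move=> v; rewrite E1.
  exists Ts'; split=> [v|]; first by rewrite E' E1.
  apply: perm_trans P'; apply: perm_trans (_ : perm_eq _ (trails_edges Ts ++ _)) _.
    by rewrite perm_cat2l; apply: trail_perm tr.
  by rewrite catA perm_cat2r.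
have /hasP[t tTs tx] : has (fun t => (t.1 == x) || (last t.1 t.2 == x)) Ts.
  apply: contraTT (pos x) => /hasPn no; rewrite -eqn0Ngt /ends big_seq big1 // => t /no.
  by rewrite negb_or => /andP[/negPf-> /negPf->].
case/splitPr: Ts / tTs pos => Ta Tb pos.
suff [q [Eq Pq]] : exists q, last t.1 q = last t.1 t.2 /\
    perm_eq (walk_edges t.1 t.2 ++ walk_edges x p) (walk_edges t.1 q).
  exists (Ta ++ (t.1, q) :: Tb); split=> [v|].
    by rewrite /ends !big_cat !big_cons /= Eq.
  rewrite /trails_edges !map_cat !flatten_cat /= -catA perm_cat2l.
  by rewrite perm_catAC perm_cat2r.
case/orP: tx => /eqP tx.
  exists (p ++ t.2); rewrite last_cat walk_edges_cat tx lx perm_catC.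
  by split.
exists (t.2 ++ p); rewrite last_cat walk_edges_cat tx lx.
by split.
Qed.

(** * Vertex sums of labelings along trails *)

(* [pairing b a h]: among the true entries of [b], [a] disjoint pairs are
   adjacent and [h] entries are left alone. *)
Inductive pairing : seq bool -> nat -> nat -> Prop :=
| PairNil : pairing [::] 0 0
| PairSkip b a h : pairing b a h -> pairing (false :: b) a h
| PairAlone b a h : pairing b a h -> pairing (true :: b) a h.+1
| PairTwo b a h : pairing b a h -> pairing [:: true, true & b] a.+1 h.

Lemma pairing_cat b a h b' a' h' : pairing b a h -> pairing b' a' h' ->
  pairing (b ++ b') (a + a') (h + h').
Proof. by move=> P P'; elim: P => //= *; rewrite ?addSn; constructor. Qed.

Lemma pairing_count b a h : pairing b a h -> count id b = 2 * a + h.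
Proof. elim=> //= *; lia. Qed.

(** Each inner visit to [v] pairs the edges entering and leaving it; only the first and the last
    edge can stay alone. *)
Lemma pairing_walk v x p : (forall e, e \in walk_edges x p -> #|e| = 2) ->
  exists a h, pairing [seq v \in (e : {set T}) | e <- walk_edges x p] a h /\
    h <= (x == v) + (last x p == v).
Proof.
have neq (x1 y1 : T) s : (forall e, e \in [set x1; y1] :: s -> #|e| = 2) -> x1 != y1.
  by move/(_ _ (mem_head _ _)); rewrite cards2; case: (x1 != y1).
have tl (e1 : {set T}) s : (forall e, e \in e1 :: s -> #|e| = 2) ->
    forall e, e \in s -> #|e| = 2.
  by move=> H e es; apply: H; rewrite inE es orbT.
have [n] := ubnP (size p); elim: n p x => // n IH [|y p] x lt sim.
  by exists 0, 0; split=> //; constructor.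
have xy := neq _ _ _ sim; have sim' := tl _ _ sim; rewrite /= !inE.
have [Exv|xv] := eqVneq v x.
  have [//|a [h [P le]]] := IH p y _ sim'; exists a, h.+1; split; first by constructor.
  have yv : (y == v) = false by rewrite Exv eq_sym (negPf xy).
  by move: le; rewrite yv; lia.
have [Eyv|yv] := eqVneq v y; last first.
  have [//|a [h [P le]]] := IH p y _ sim'; exists a, h; split; first by constructor.
  by move: le; rewrite [y == v]eq_sym (negPf yv).
case: p lt sim sim' => [|z p] lt sim sim' /=.
  exists 0, 1; split; first by do 2 constructor.
  by rewrite -Eyv eqxx; lia.
have yz := neq _ _ _ sim'; have sim2 := tl _ _ sim'.
have [|a [h [P le]]] := IH p z _ sim2; first by move: lt => /=; lia.
exists a.+1, h; rewrite !inE Eyv eqxx /= -Eyv; split; first by constructor.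
by move: le; rewrite [z == v]eq_sym Eyv (negPf yz).
Qed.

Lemma pairing_trails v Ts : (forall e, e \in trails_edges Ts -> #|e| = 2) ->
  exists a h, pairing [seq v \in (e : {set T}) | e <- trails_edges Ts] a h /\ h <= ends Ts v.
Proof.
elim: Ts => [|[x p] Ts IH] sim; first by exists 0, 0; split=> //; constructor.
have [e eTs|a [h [P le]]] := IH; first by apply: sim; rewrite /trails_edges /= mem_cat eTs orbT.
have [e ep|a' [h' [P' le']]] := @pairing_walk v x p.
  by apply: sim; rewrite /trails_edges /= mem_cat ep.
exists (a' + a), (h' + h); rewrite /trails_edges /= map_cat; split.
  exact: pairing_cat.
by rewrite /ends big_cons leq_add.
Qed.

(** The sum of [w (i + j)] over the positions [j] of true entries in [b]. *)
Fixpoint weight (w : nat -> nat) i (b : seq bool) :=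
  if b is c :: b' then c * w i + weight w i.+1 b' else 0.

Lemma weight_index (w : nat -> nat) (A : eqType) (P : pred A) (L : seq A) i : uniq L ->
  \sum_(e <- L | P e) w (i + index e L) = weight w i (map P L).
Proof.
elim: L i => [|e L IH] i /=; first by rewrite big_nil.
case/andP=> eL /IH <-; rewrite big_cons eqxx addn0.
rewrite [in LHS]big_seq_cond [in RHS]big_seq_cond.
have -> : \sum_(j <- L | (j \in L) && P j) w (i + (if e == j then 0 else (index j L).+1))
    = \sum_(j <- L | (j \in L) && P j) w (i.+1 + index j L).
  apply: eq_bigr => j /andP[jL _]; case: eqP => [E|_]; last by rewrite addnS.
  by rewrite E jL in eL.
by case: (P e); rewrite ?mul1n.
Qed.

Lemma weight_bounds (w : nat -> nat) N lo hi M b a h i :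
  (forall j, j < N -> w j <= M) ->
  (forall j, j.+1 < N -> lo <= w j + w j.+1 <= hi) ->
  pairing b a h -> i + size b <= N ->
  a * lo <= weight w i b <= a * hi + h * M.
Proof.
move=> wM whi P; elim: P i => //= {}b {}a {}h _ IH i le.
- by rewrite mul0n add0n; apply: IH; lia.
- have := IH i.+1 ltac:(lia); have := wM i ltac:(lia); lia.
- have := IH i.+2 ltac:(lia); have := whi i ltac:(lia); lia.
Qed.

End Trails.

(* 0, m-1, 1, m-2, ... *)
Definition zigzag m i := if odd i then m.-1 - i./2 else i./2.

Lemma zigzag_lt m i : i < m -> zigzag m i < m.
Proof.
by rewrite /zigzag; have := odd_double_half i; case: (odd i) => /=; lia.
Qed.

Lemma zigzag_inj m i j : i < m -> j < m -> zigzag m i = zigzag m j -> i = j.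
Proof.
rewrite /zigzag; have := odd_double_half i; have := odd_double_half j.
by case: (odd i); case: (odd j) => /=; lia.
Qed.

Lemma zigzag_consecutive m i : i.+1 < m ->
  m.-1 <= zigzag m i + zigzag m i.+1 <= m.
Proof.
rewrite /zigzag /= uphalf_half; have := odd_double_half i.
by case: (odd i) => /=; lia.
Qed.

(** The zigzag labels follow the concatenated trails. A vertex sum consists of [a] pairs, each [m-1]
    or [m], and [h] single labels, with [2 * a + h = k] and [h] at most the number of trail ends
    there. *)
Lemma narrow_labeling (G : sgraph) k : k_regular k G -> 2 < k ->
  exists g : {set G} -> nat,
  [/\ {in edges G, forall e, g e < #|edges G|}, {in edges G &, injective g}
    & forall v v', vertex_sum g v + k * #|G|.-1 < vertex_sum g v' + k * #|edges G|].
Proof.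
move=> Gk k3; set m := #|edges G|.
have sim : simple (edges G) by move=> e; apply: edge_card.
have degE v := deg_in_edges v Gk.
pose c := if odd k then 1 else 2.
have [Ts [TsE Tsperm]] : exists Ts : seq (G * seq G), (forall v, ends Ts v = c) /\
    perm_eq (enum (edges G)) (trails_edges Ts).
  suff [F [Ts0 [simF evenF E0 P0]]] : exists F (Ts0 : seq (G * seq G)),
      [/\ simple F, forall v, ~~ odd (deg_in F v), forall v, ends Ts0 v = c
        & perm_eq (enum (edges G)) (trails_edges Ts0 ++ enum F)].
    have [|Ts [E P]] := @splice_decomposition _ F Ts0 simF evenF.
      by move=> v; rewrite E0 /c; case: ifP.
    exists Ts; split=> [v|]; first by rewrite E E0.
    exact: perm_trans P0 P.
  rewrite /c; case: ifP => ok.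
    have [Ts [F [sF eF E P]]] := odd_decomposition sim.
    by exists F, Ts; split=> // v; rewrite E degE ok.
  (* For even [k], an edgeless trail at each vertex provides two ends; all edges are then spliced
     in. *)
  exists (edges G), [seq (v, [::]) | v <- enum G]; split=> // [v|v|].
  - by rewrite degE ok.
  - rewrite /ends big_map big_enum /= (bigD1 v) //= eqxx big1 // => u /negPf uv.
    by rewrite uv.
  - rewrite (_ : trails_edges _ = [::]) //.
    by rewrite /trails_edges -map_comp; elim: (enum G).
pose L := trails_edges Ts.
have LE : L =i edges G by move=> e; rewrite -(perm_mem Tsperm) mem_enum.
have Lu : uniq L by rewrite -(perm_uniq Tsperm) enum_uniq.
have Ls : size L = m by rewrite -(perm_size Tsperm) -cardE.
have Llt e : e \in edges G -> index e L < m by rewrite -LE -Ls index_mem.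
pose g (e : {set G}) := zigzag m (index e L); exists g; split.
- by move=> e /Llt/zigzag_lt.
- move=> e e' eE e'E E.
  have Ei := zigzag_inj (Llt _ eE) (Llt _ e'E) E.
  by rewrite -[e](nth_index set0 (s := L)) ?LE // Ei nth_index ?LE.
have bounds v : exists a h, [/\ 2 * a + h = k, h <= c &
    a * m.-1 <= vertex_sum g v <= a * m + h * m.-1].
  have [e|a [h [P le]]] := @pairing_trails _ v Ts; first by rewrite LE; apply: edge_card.
  exists a, h; split; rewrite -?(TsE v) //.
    rewrite -(pairing_count P) count_map -(degE v) /deg_in cardsE -sum1_card.
    by rewrite -big_enum_cond (perm_big _ Tsperm) sum1_count.
  have -> : vertex_sum g v =
      weight (zigzag m) 0 [seq v \in (e : {set G}) | e <- L].
    rewrite -weight_index // /vertex_sum -big_enum_cond.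
    by rewrite (perm_big _ Tsperm).
  apply: (weight_bounds (N := m) _ _ P); rewrite ?size_map ?Ls //.
  - by move=> j /zigzag_lt; lia.
  - by move=> j /zigzag_consecutive.
move=> v v'; have [a [h [Ek hc /andP[_ up]]]] := bounds v.
have [a' [h' [Ek' hc' /andP[lo _]]]] := bounds v'.
have n0 : 0 < #|G| by apply/card_gt0P; exists v.
have := handshake Gk; rewrite -/m => Em.
(* The sums thus have to differ by less than [(k - 2) * m + k]. *)
have kn : k * #|G|.-1 + k = 2 * m by rewrite -mulnSr prednK // -Em mulnC.
have m0 : 0 < m by nia.
have am : a' * m = a' * m.-1 + a' by rewrite -mulnSr prednK.
move: hc hc' Ek Ek'; rewrite /c; case: ifP => ok hc hc' Ek Ek'.
  have Ea : a = a' by lia.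
  have Eh : h = 1 by lia.
  have kmm : 3 * m <= k * m by rewrite leq_mul2r k3 orbT.
  by move: up; rewrite -Ea in am lo; rewrite Eh mul1n; clear -am lo kn m0 Ek Eh kmm; lia.
have k4 : 3 < k by lia.
have kmm : 4 * m <= k * m by rewrite leq_mul2r k4 orbT.
have h02 : h = 0 \/ h = 2 by lia.
have h02' : h' = 0 \/ h' = 2 by lia.
(* As [h] and [h'] are 0 or 2, the numbers of pairs differ by at most one. *)
have [Ea|[Ea|Ea]] : a = a' \/ a = a'.+1 /\ h = 0 \/ a' = a.+1 by lia.
- have hm : h * m.-1 <= 2 * m.-1 by rewrite leq_mul2r hc orbT.
  by rewrite Ea in up; clear -am lo up kn m0 Ek' k4 kmm hm; lia.
- by case: Ea up => -> ->; rewrite mulSn; clear -am lo kn m0 Ek' k4 kmm; lia.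
- have hm : h * m.-1 <= 2 * m.-1 by rewrite leq_mul2r hc orbT.
  by rewrite Ea mulSn in am lo; clear -am lo up kn m0 Ek' k4 kmm hm Ea; lia.
Qed.

(** * The product theorem *)

(** For [k] at least 3 the narrow labeling has room for [k * #|G|.-1], hence for [l * #|G|.-1];
    three small pairs of degrees remain. *)
Lemma antimagic_cart_le (G H : sgraph) k l :
  k_regular k G -> k_regular l H -> 0 < l <= k -> antimagic (cart G H).
Proof.
move=> Gk Hl /andP[l0 lk]; have [k3|k2] := ltnP 2 k.
  have [g [glt ginj narrow]] := narrow_labeling Gk k3.
  apply: (antimagic_cart_narrow Gk Hl l0 glt ginj) => v v'.
  by apply: leq_ltn_trans (narrow v v'); rewrite leq_add2l leq_mul2r lk orbT.
case: k l k2 l0 lk Gk Hl => [|[|[|//]]] [|[|[|//]]] //= _ _ _ Gk Hl.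
- exact: antimagic_cart11.
- exact: antimagic_cart21.
- exact: antimagic_cart22.
Qed.

Lemma antimagic_cart_regular (G H : sgraph) k l :
  0 < k -> 0 < l -> k_regular k G -> k_regular l H -> antimagic (cart G H).
Proof.
move=> k0 l0 Gk Hl; have [lk|kl] := leqP l k.
  by apply: antimagic_cart_le Gk Hl _; rewrite l0.
by apply/antimagic_cartC/(antimagic_cart_le Hl Gk); rewrite k0 ltnW.
Qed.

Lemma cart_iter_regular n (H : 'I_n.+1 -> sgraph) :
  (forall i, exists2 k, 0 < k & k_regular k (H i)) ->
  exists2 k, 0 < k & k_regular k (cart_iter H).
Proof.
elim: n H => [|n IH] H Hreg /=; first exact: Hreg.
have [k k0 Gk] := IH _ (fun i => Hreg (widen_ord (leqnSn n.+1) i)).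
have [l l0 Hl] := Hreg ord_max.
by exists (k + l); [rewrite addn_gt0 k0 | apply: cart_regular].
Qed.

Theorem theorem1p3 (r : nat) (H : 'I_r -> sgraph) (hr : 2 <= r)
    (hreg : forall i : 'I_r, exists2 k : nat, 0 < k & k_regular k (H i)) :
  antimagic (cart_prod H).
Proof.
case: r H hr hreg => [|[|n]] H //= _ hreg.
have [k k0 Gk] := cart_iter_regular (fun i => hreg (widen_ord (leqnSn n.+1) i)).
have [l l0 Hl] := hreg ord_max.
exact: antimagic_cart_regular k0 l0 Gk Hl.
Qed.
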